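(* Let $D=(P,\mathcal{B})$ be a non-trivial $(v,k,\lambda)$-symmetric design and let $\Gamma_1(D)$ be its flag-graph. Then one of the following holds: (i) if $\lambda=1$ then $\Gamma_1(D)$ is a $(vk,\,2(k-1),\,k-2;\,0,1)$-QSRG; (ii) if $\lambda>1$ then $\Gamma_1(D)$ is a $(vk,\,2(k-1),\,k-2;\,0,1,2)$-QSRG.
   Context: Let $v,b,r,k,\lambda$ be positive integers with $k>1$. A $(v,b,r,k,\lambda)$-balanced incomplete block design (BIBD) $D=(P,\mathcal{B})$ consists of a set $P$ of $v$ points and a set $\mathcal{B}$ of $b$ blocks, each block being a $k$-subset of $P$ (so there are no repeated blocks), such that every unordered pair of distinct points is contained in exactly $\lambda$ blocks; every point then lies in exactly $r$ blocks. $D$ is non-trivial if $v-k>1$. A $(v,k,\lambda)$-symmetric design is a $(v,v,k,k,\lambda)$-BIBD, i.e. one with $b=v$ and $r=k$. A flag of $D$ is an ordered pair $(p,c)$ with $p\in P$, $c\in\mathcal{B}$ and $p\in c$. The flag-graph $\Gamma_1(D)$ is the simple graph whose vertices are the flags of $D$, two different vertices $(p,c)$ and $(q,d)$ being adjacent if and only if $p=q$ or $c=d$. An $(n,t,\eta;\mu_1,\ldots,\mu_s)$-quasi-strongly regular graph (QSRG) is a graph on $n$ vertices that is $t$-regular, in which any two adjacent vertices have exactly $\eta$ common neighbours, and the number of common neighbours of any two distinct non-adjacent vertices belongs to $\{\mu_1,\ldots,\mu_s\}$. *)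

(* Defs.v *)
From mathcomp Require Import all_boot.

Set Implicit Arguments.
Unset Strict Implicit.
Unset Printing Implicit Defensive.

(* A design is given by its point set, a finType P, and its set of blocks Bs;
   as Bs is a set of subsets of P, there are no repeated blocks. *)
Record bibd (P : finType) (Bs : {set {set P}}) (v b r k lam : nat) : Prop :=
  Bibd {
    bibd_pos : [&& 0 < v, 0 < b, 0 < r, 1 < k & 0 < lam];
    bibd_points : #|P| = v;
    bibd_blocks : #|Bs| = b;
    bibd_block_size : forall B : {set P}, B \in Bs -> #|B| = k;
    bibd_balanced : forall p q : P, p != q ->
      #|[set B in Bs | (p \in B) && (q \in B)]| = lam;
    (* This follows from the other fields, but it is what gives r its meaning. *)
    bibd_replication : forall p : P, #|[set B in Bs | p \in B]| = r
  }.

Definition nontrivial_design (v k : nat) : Prop := 1 < v - k.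

Definition symmetric_design (P : finType) (Bs : {set {set P}})
    (v k lam : nat) : Prop :=
  bibd Bs v v k k lam.

Record sgraph := SGraph {
  vertex :> finType;
  adj : rel vertex;
  adj_sym : symmetric adj;
  adj_irr : irreflexive adj
}.

Definition neighbours (G : sgraph) (x : G) : {set G} := [set y | adj x y].

Definition common_neighbours (G : sgraph) (x y : G) : {set G} :=
  neighbours x :&: neighbours y.

Record qsrg (G : sgraph) (n t eta : nat) (mus : seq nat) : Prop := Qsrg {
  qsrg_order : #|G| = n;
  qsrg_regular : forall x : G, #|neighbours x| = t;
  qsrg_adj : forall x y : G, adj x y -> #|common_neighbours x y| = eta;
  qsrg_nonadj : forall x y : G, x != y -> ~~ adj x y ->
    #|common_neighbours x y| \in mus
}.

Section FlagGraph.

Variables (P : finType) (Bs : {set {set P}}).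

Definition flag : finType :=
  {pc : P * {set P} | (pc.2 \in Bs) && (pc.1 \in pc.2)}.

Definition flag_point (x : flag) : P := (val x).1.

Definition flag_block (x : flag) : {set P} := (val x).2.

Definition flag_adj : rel flag := fun x y =>
  (x != y) && ((flag_point x == flag_point y) || (flag_block x == flag_block y)).

Lemma flag_adj_sym : symmetric flag_adj.
Proof.
move=> x y; rewrite /flag_adj eq_sym (eq_sym (flag_point x)).
by rewrite (eq_sym (flag_block x)).
Qed.

Lemma flag_adj_irr : irreflexive flag_adj.
Proof. by move=> x; rewrite /flag_adj eqxx. Qed.

Definition flag_graph : sgraph := SGraph flag_adj_sym flag_adj_irr.

End FlagGraph.

(* Main.v *)
Require Import Defs.
From mathcomp Require Import all_boot.

(** A flag is an edge of the incidence graph, the bipartite graph between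
    points and blocks, and the flag graph is the line graph of that graph.
    Everything follows from counting edges at vertices of a bipartite graph.

    The edges at a point or at a block form a star ([point_star],
    [block_star]); in a symmetric design every star has [k] flags, because
    [r = k].  The neighbours of a flag are the other members of its two stars,
    which share only that flag, so there are [2 * (k - 1)] of them.  Two
    adjacent flags lie in one common star, and since a bipartite graph has no
    triangle their common neighbours are the [k - 2] other members of that
    star.

    If [(p, c)] and [(q, d)] are distinct and not adjacent, then [p != q] and
    [c != d], and the only edges that meet both are [(p, d)] and [(q, c)], when
    these are flags ([card_common_neighbours_nonadj]).  This gives 0, 1 or 2
    common neighbours.  Having both would put [p] and [q] in the two blocks [c]
    and [d], which [lam = 1] forbids ([blocks_through_pair]). *)

Lemma cardsD2 (T : finType) (A : {set T}) (a b : T) :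
  a != b -> a \in A -> b \in A -> #|A :\ a :\ b| = #|A| - 2.
Proof.
move=> ab Aa Ab; rewrite (cardsD1 a A) Aa (cardsD1 b (A :\ a)).
by rewrite !inE eq_sym ab Ab !addnA addKn.
Qed.

Section FlagGraphCounting.

Set Implicit Arguments.
Unset Strict Implicit.

Variables (P : finType) (Bs : {set {set P}}).
Implicit Types (x y z : flag Bs) (p : P) (B : {set P}).

Definition point_star p : {set flag Bs} := [set x | flag_point x == p].

Definition block_star B : {set flag Bs} := [set x | flag_block x == B].

Lemma flag_block_in x : flag_block x \in Bs.
Proof. by have /andP[] := valP x. Qed.

Lemma flag_point_in x : flag_point x \in flag_block x.
Proof. by have /andP[] := valP x. Qed.

Lemma flag_eqE x y :
  (x == y) = (flag_point x == flag_point y) && (flag_block x == flag_block y).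
Proof. by []. Qed.

Lemma flag_exists p B : B \in Bs -> p \in B ->
  exists x, flag_point x = p /\ flag_block x = B.
Proof.
move=> BsB Bp; have fl : ((p, B).2 \in Bs) && ((p, B).1 \in (p, B).2).
  by rewrite BsB Bp.
by exists (Sub (p, B) fl).
Qed.

Lemma card_point_star p : #|point_star p| = #|[set B in Bs | p \in B]|.
Proof.
have inj : {in point_star p &, injective (@flag_block P Bs)}.
  move=> x y; rewrite !inE => /eqP xp /eqP yp xy.
  by apply/eqP; rewrite flag_eqE xp yp xy !eqxx.
rewrite -(card_in_imset inj); congr #|pred_of_set _|; apply/setP => B.
apply/imsetP/idP => [[x] |].
  rewrite !inE => /eqP <- ->.
  by rewrite flag_block_in flag_point_in.
rewrite inE => /andP[BsB Bp]; have [x [xp xB]] := flag_exists BsB Bp.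
by exists x; rewrite // inE xp.
Qed.

Lemma card_block_star B : B \in Bs -> #|block_star B| = #|B|.
Proof.
move=> BsB; have inj : {in block_star B &, injective (@flag_point P Bs)}.
  move=> x y; rewrite !inE => /eqP xB /eqP yB xy.
  by apply/eqP; rewrite flag_eqE xB yB xy !eqxx.
rewrite -(card_in_imset inj); congr #|pred_of_set _|; apply/setP => p.
apply/imsetP/idP => [[x] | Bp].
  by rewrite inE => /eqP <- ->; rewrite flag_point_in.
have [x [xp xB]] := flag_exists BsB Bp.
by exists x; rewrite // inE xB.
Qed.

Lemma card_point_block_star p B :
  B \in Bs -> #|point_star p :&: block_star B| = (p \in B).
Proof.
move=> BsB; case: (boolP (p \in B)) => [Bp | nBp]; last first.
  apply: eq_card0 => x; rewrite !inE; apply/negP => /andP[/eqP xp /eqP xB].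
  by move: (flag_point_in x); rewrite xp xB (negPf nBp).
have [x [xp xB]] := flag_exists BsB Bp.
rewrite -[RHS](cards1 x); congr #|pred_of_set _|; apply/setP => y.
by rewrite !inE flag_eqE xp xB.
Qed.

Lemma card_flags : #|flag Bs| = \sum_p #|point_star p|.
Proof.
rewrite -sum1_card (partition_big (@flag_point P Bs) predT) //=.
by apply: eq_bigr => p _; rewrite -sum1_card; apply: eq_bigl => x; rewrite inE.
Qed.

Lemma neighboursE x :
  neighbours (G := flag_graph Bs) x =
  (point_star (flag_point x) :\ x) :|: (block_star (flag_block x) :\ x).
Proof.
apply/setP => y; rewrite !inE /= /flag_adj (eq_sym x) (eq_sym (flag_point x)).
by rewrite (eq_sym (flag_block x)) andb_orr.
Qed.

Lemma card_neighbours x :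
  #|neighbours (G := flag_graph Bs) x| =
  #|point_star (flag_point x)|.-1 + #|block_star (flag_block x)|.-1.
Proof.
rewrite neighboursE cardsU.
(* The two stars of a flag share only that flag. *)
have -> : (point_star (flag_point x) :\ x) :&: (block_star (flag_block x) :\ x)
          = set0.
  apply/setP => y; rewrite !inE flag_eqE.
  by case: (flag_point y == _); case: (flag_block y == _).
rewrite cards0 subn0 (cardsD1 x (point_star _)) (cardsD1 x (block_star _)).
by rewrite !inE !eqxx.
Qed.

(** A common neighbour outside the common star would have to lie on both blocks,
    which are different. *)
Lemma card_common_neighbours_point x y :
  x != y -> flag_point x = flag_point y ->
  #|common_neighbours (G := flag_graph Bs) x y| =
  #|point_star (flag_point x)| - 2.
Proof.
move=> xy pxy; have cxy : flag_block x != flag_block y.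
  by move: xy; rewrite flag_eqE pxy eqxx.
rewrite -(cardsD2 _ _ _ _ xy) ?inE ?pxy //; congr #|pred_of_set _|; apply/setP => z.
rewrite !inE /= /flag_adj (eq_sym x) (eq_sym y) pxy (eq_sym (flag_point y)).
case: (z == x); case: (z == y); rewrite ?andbF //=.
case: (flag_point z == _) => //=.
by apply/negP => /andP[/eqP cx /eqP cy]; rewrite cx cy eqxx in cxy.
Qed.

(** The dual of [card_common_neighbours_point], with points and blocks
    exchanged. *)
Lemma card_common_neighbours_block x y :
  x != y -> flag_block x = flag_block y ->
  #|common_neighbours (G := flag_graph Bs) x y| =
  #|block_star (flag_block x)| - 2.
Proof.
move=> xy cxy; have pxy : flag_point x != flag_point y.
  by move: xy; rewrite flag_eqE cxy eqxx andbT.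
rewrite -(cardsD2 _ _ _ _ xy) ?inE ?cxy //; congr #|pred_of_set _|; apply/setP => z.
rewrite !inE /= /flag_adj (eq_sym x) (eq_sym y) cxy (eq_sym (flag_block y)).
case: (z == x); case: (z == y); rewrite ?andbF //=.
case: (flag_block z == _); rewrite ?orbT ?orbF //=.
by apply/negP => /andP[/eqP px /eqP py]; rewrite px py eqxx in pxy.
Qed.

(** Two disjoint edges of the incidence graph can only be joined by its edges
    [(p, d)] and [(q, c)], as there is no edge between two points or between
    two blocks. *)
Lemma card_common_neighbours_nonadj x y :
  flag_point x != flag_point y -> flag_block x != flag_block y ->
  #|common_neighbours (G := flag_graph Bs) x y| =
  (flag_point x \in flag_block y) + (flag_point y \in flag_block x).
Proof.
move=> pxy cxy.
rewrite -(card_point_block_star _ (flag_block_in y)).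
rewrite -(card_point_block_star _ (flag_block_in x)).
rewrite -[RHS]subn0 -cardsUI.
have -> : point_star (flag_point x) :&: block_star (flag_block y) :&:
          (point_star (flag_point y) :&: block_star (flag_block x)) = set0.
  apply/setP => z; rewrite !inE; apply/negP.
  move=> /andP[/andP[/eqP zx _] /andP[/eqP zy _]].
  by rewrite -zx zy eqxx in pxy.
rewrite cards0 addn0 subn0; congr #|pred_of_set _|; apply/setP => z.
rewrite !inE /= /flag_adj !flag_eqE (eq_sym _ (flag_point z)).
rewrite (eq_sym _ (flag_block z)) (eq_sym _ (flag_point z)).
rewrite (eq_sym _ (flag_block z)).
case: (eqVneq (flag_point z) (flag_point x)) => [-> | _];
  case: (eqVneq (flag_block z) (flag_block x)) => [-> | _];
  by rewrite ?(negPf pxy) ?(negPf cxy) ?eqxx //= ?andbF ?orbF //;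
     case: (_ == _) => //; case: (_ == _).
Qed.

Lemma nonadj_flags x y :
  x != y -> ~~ flag_adj x y ->
  flag_point x != flag_point y /\ flag_block x != flag_block y.
Proof. by rewrite /flag_adj => -> /=; rewrite negb_or => /andP. Qed.

(** With [lam = 1] the points and blocks form a linear space: two points
    determine their block. *)
Lemma blocks_through_pair (v b r k : nat) (p q : P) (c d : {set P}) :
  bibd Bs v b r k 1 -> p != q -> c \in Bs -> d \in Bs ->
  p \in c -> q \in c -> p \in d -> q \in d -> c = d.
Proof.
move=> hD pq Bc Bd pc qc pd qd.
have /eqP/cards1P[e he] := bibd_balanced hD pq.
have /set1P -> : c \in [set e] by rewrite -he !inE Bc pc qc.
by have /set1P -> : d \in [set e] by rewrite -he !inE Bd pd qd.
Qed.

(** Only the numbers of common neighbours of non-adjacent flags depend on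
    [lam], so the parameter [mus] is left open here. *)
Lemma flag_graph_qsrg (v k lam : nat) (mus : seq nat) :
  symmetric_design Bs v k lam ->
  (forall x y : flag Bs,
     flag_point x != flag_point y -> flag_block x != flag_block y ->
     (flag_point x \in flag_block y) + (flag_point y \in flag_block x) \in mus)
  -> qsrg (flag_graph Bs) (v * k) (2 * (k - 1)) (k - 2) mus.
Proof.
move=> hD hmus.
have pk p : #|point_star p| = k.
  by rewrite card_point_star (bibd_replication hD).
have bk (x : flag Bs) : #|block_star (flag_block x)| = k.
  by rewrite card_block_star ?(bibd_block_size hD) ?flag_block_in.
split.
- rewrite card_flags (eq_bigr (fun=> k)) => [|p _]; last exact: pk.
  by rewrite sum_nat_const (bibd_points hD).
- by move=> x; rewrite card_neighbours pk bk subn1 mul2n addnn.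
- move=> x y /andP[xy /orP[] /eqP exy].
    by rewrite card_common_neighbours_point ?pk.
  by rewrite card_common_neighbours_block ?bk.
- move=> x y xy /(nonadj_flags xy)[pxy cxy].
  by rewrite card_common_neighbours_nonadj ?hmus.
Qed.

End FlagGraphCounting.

Theorem corollary1 (P : finType) (Bs : {set {set P}}) (v k lam : nat)
  (hD : symmetric_design Bs v k lam) (hnt : nontrivial_design v k) :
  (lam = 1 ->
     qsrg (flag_graph Bs) (v * k) (2 * (k - 1)) (k - 2) [:: 0; 1]) /\
  (1 < lam ->
     qsrg (flag_graph Bs) (v * k) (2 * (k - 1)) (k - 2) [:: 0; 1; 2]).
Proof.
split=> hlam; apply: (flag_graph_qsrg hD) => x y pxy cxy; last first.
  by do 2 case: (_ \in _).
rewrite hlam in hD.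
case: (boolP (flag_point x \in flag_block y)) => [xy | _]; last by case: (_ \in _).
case: (boolP (flag_point y \in flag_block x)) => [yx | _] //.
move/eqP: cxy; case.
apply: (blocks_through_pair hD pxy); by rewrite ?flag_block_in ?flag_point_in.
Qed.
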